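(* Let $k=\mathbb C$. Let $n\ge 3$ and let $\lambda_1,\dots,\lambda_n$ be distinct elements of $k$. Let $f(x)=\prod_{i=1}^n(x-\lambda_i)$ and let $X=Z(y^2-f(x))$ be the corresponding affine hyperelliptic curve in $\mathbb A^2$. For a sufficiently general choice of $\lambda_1,\dots,\lambda_n$, the group of units $\mathcal O^\ast(X)$ is equal to $k^\ast$.
   Context: $Z(g)$ is the zero set of $g$; $\mathcal O(X)=k[x,y]/(y^2-f(x))$ is the coordinate ring of $X$ and $\mathcal O^\ast(X)$ is its group of units. ''For a sufficiently general choice of $\lambda_1,\dots,\lambda_n$'' means: for all $(\lambda_1,\dots,\lambda_n)\in\mathbb C^n$ with distinct entries outside some countable union of proper Zariski-closed subsets of $\mathbb C^n$ (depending only on $n$). *)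

(* Defs.v *)
From HB Require Import structures.
From mathcomp Require Import all_boot all_order all_algebra.
From mathcomp Require Import boolp classical_sets reals.
From mathcomp Require Import complex mpoly.

Set Implicit Arguments.
Unset Strict Implicit.
Unset Printing Implicit Defensive.

Import GRing.Theory.

Local Open Scope classical_set_scope.
Local Open Scope ring_scope.
Local Open Scope quotient_scope.

(* A point of affine n-space over K is a function 'I_n -> K. *)
Definition zero_set (K : fieldType) (n : nat) (S : set {mpoly K[n]}) :
  set ('I_n -> K) := [set v | forall p, S p -> p.@[v] = 0].

Definition zariski_closed (K : fieldType) (n : nat) (A : set ('I_n -> K)) :=
  exists S : set {mpoly K[n]}, A = zero_set S.

Definition split_poly (K : fieldType) (n : nat) (lam : 'I_n -> K) : {poly K} :=
  \prod_(i < n) ('X - (lam i)%:P).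

Section HyperellipticCurve.

Variables (K : closedFieldType) (f : {poly K}).

Definition coord_x : {mpoly K[2]} := 'X_(inord 0).
Definition coord_y : {mpoly K[2]} := 'X_(inord 1).

Definition curve_eqn : {mpoly K[2]} := coord_y ^+ 2 - horner_alg coord_x f.

Definition curve : set ('I_2 -> K) := zero_set [set curve_eqn].

Definition curve_ideal : {pred {mpoly K[2]}} :=
  [pred p | `[< exists q, p = q * curve_eqn >]].

Lemma horner_alg_meval (v : 'I_2 -> K) :
  (horner_alg coord_x f).@[v] = f.[v (inord 0)].
Proof.
elim/poly_ind: f => [|p c IHp]; first by rewrite !rmorph0 horner0.
rewrite rmorphD rmorphM /= horner_algX horner_algC mevalD mevalM IHp.
by rewrite mevalZ rmorph1 mulr1 mevalXU hornerMXaddC.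
Qed.

(* MathComp ideals exclude 1; a point of the curve witnesses properness. *)
Lemma curve_nonempty : curve !=set0.
Proof.
have [y hy] : exists y : K, y ^+ 2 = f.[0].
  have [y hy] := @solve_monicpoly K 2 (nth 0 [:: f.[0]]) isT.
  by exists y; rewrite hy !big_ord_recl big_ord0 /= expr0 mulr1 mul0r !addr0.
exists (fun i => if i == inord 0 then 0 else y) => p /= ->.
rewrite /curve_eqn mevalB horner_alg_meval eqxx rmorphXn /= mevalXU.
by rewrite -val_eqE /= !inordK //= hy subrr.
Qed.

Lemma curve_ideal_closed : idealr_closed curve_ideal.
Proof.
split.
- by apply/asboolP; exists 0; rewrite mul0r.
- apply/asboolP => -[q h].
  have [v hv] := curve_nonempty.
  have := congr1 (meval v) h.
  by rewrite rmorph1 rmorphM /= (hv _ erefl) mulr0 => /eqP; rewrite oner_eq0.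
- move=> a u v /asboolP[p ->] /asboolP[q ->]; apply/asboolP.
  by exists (a * p + q); rewrite mulrDl mulrA.
Qed.

HB.instance Definition _ :=
  isIdealr.Build {mpoly K[2]} curve_ideal curve_ideal_closed.

Definition coord_ring := {ideal_quot curve_ideal}.

HB.instance Definition _ := GRing.ComNzRing.on coord_ring.

Definition coord_unit : pred coord_ring := [pred u | `[< exists v, v * u = 1 >]].

Definition coord_inv (u : coord_ring) : coord_ring :=
  if pselect (exists v, v * u = 1) is left h then projT1 (cid h) else u.

Lemma coord_mulVr : {in coord_unit, left_inverse 1 coord_inv *%R}.
Proof.
by move=> u /asboolP hu; rewrite /coord_inv; case: pselect => // h; case: cid.
Qed.

Lemma coord_unitPl (u v : coord_ring) : v * u = 1 -> coord_unit u.
Proof. by move=> h; apply/asboolP; exists v. Qed.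

Lemma coord_inv_out : {in [predC coord_unit], coord_inv =1 id}.
Proof.
by move=> u /asboolP hu; rewrite /coord_inv; case: pselect.
Qed.

HB.instance Definition _ := GRing.ComNzRing_hasMulInverse.Build coord_ring
  coord_mulVr coord_unitPl coord_inv_out.

Definition coord_class (p : {mpoly K[2]}) : coord_ring := \pi_coord_ring p.

Definition coord_const (c : K) : coord_ring := coord_class c%:MP.

End HyperellipticCurve.

Definition ring_units (A : unitRingType) : set A := [set u | u \is a GRing.unit].

Arguments coord_class {K} f p.
Arguments coord_const {K} f c.
Arguments ring_units A : clear implicits.

(* Main.v *)
Require Import Defs.
From HB Require Import structures.
From mathcomp Require Import all_boot all_order all_algebra.
From mathcomp Require Import boolp classical_sets reals.
From mathcomp Require Import complex mpoly.
From mathcomp Require Import ring zify.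

Set Implicit Arguments.
Unset Strict Implicit.
Unset Printing Implicit Defensive.

Import Order.TTheory GRing.Theory Num.Theory.

Local Open Scope classical_set_scope.
Local Open Scope ring_scope.

(** Let f be the product of the X - lam_i and u = A(x) + B(x) y a unit of the
    coordinate ring. Multiplying u by its conjugate A - B y gives the norm
    A^2 - f B^2, which is multiplicative, hence a unit of k[x], hence a nonzero
    constant. If B = 0, this makes A, and so u, constant. The claim is thus that
    for general roots the polynomial Pell equation A^2 - f B^2 = c has no
    solution with B <> 0 ([coord_units_const]).

    For odd n the two sides A^2 and f B^2 + c have degrees of different parity.
    For n = 2e the countably many bad sets are indexed by q = deg B. Such a
    solution makes A/B a very good approximation of sqrt f at infinity, and this
    is a linear condition on B: if T is the polynomial part of X^k sqrt f for
    k large, then X^k A - T B has small degree, so T B has no coefficients in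
    a certain window of degrees below k ([pell_window]). Conversely a B with
    this property extends to a solution ([window_pell]). As T can be
    computed by a recursion that only halves ([monic_sqrt_approx]), its
    coefficients are polynomials in the roots. So there is a matrix M, with
    polynomial entries, that fails to have full row rank at every bad tuple of
    roots.

    It remains to see that M has full row rank at one point, and for this the
    roots need not be distinct: f = X^(n-1) (X - 1) works
    ([no_pell_degenerate]). Indeed, differentiating A^2 - f B^2 = c shows that
    X^(n-2) B divides A', which is too much for the degree of A' when n > 2.
    If L is a right inverse of M at this point, det (M L) is a polynomial in the
    roots which equals 1 there and vanishes at all bad roots
    ([pell_obstruction]). *)

(** * Approximate square roots of polynomials *)

Section PolySize.
Variable R : nzRingType.
Implicit Types p q : {poly R}.

Lemma size_add_leq p q n :
  (size p <= n)%N -> (size q <= n)%N -> (size (p + q)%R <= n)%N.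
Proof.
by move=> hp hq; apply: leq_trans (size_polyD p q) _; rewrite geq_max hp.
Qed.

Lemma size_sub_leq p q n :
  (size p <= n)%N -> (size q <= n)%N -> (size (p - q)%R <= n)%N.
Proof. by move=> hp hq; apply: size_add_leq => //; rewrite size_polyN. Qed.

Lemma size_mul_le p q a b n :
    (size p <= a)%N -> (size q <= b)%N -> (a + b <= n.+1)%N ->
  (size (p * q)%R <= n)%N.
Proof. by move=> hp hq hn; have := size_polyMleq p q; lia. Qed.

End PolySize.

(** The polynomial part of the square root of a monic polynomial of degree 2d.
    Only division by 2 is used, so the lemma applies to polynomials whose
    coefficients are themselves polynomials in the roots of f; this is why it is
    stated over a ring. *)
Lemma monic_sqrt_approx (R : comNzRingType) (half : R) (h : {poly R}) d :
    half + half = 1 -> (size (h - 'X^(d + d))%R <= d + d)%N ->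
  exists T : {poly R},
    (size (T - 'X^d)%R <= d)%N /\ (size (h - T ^+ 2)%R <= d)%N.
Proof.
move=> half2 hh.
suff step j : (j <= d)%N -> exists T : {poly R},
    (size (T - 'X^d)%R <= d)%N /\ (size (h - T ^+ 2)%R <= d + d - j)%N.
  by have := step d (leqnn d); rewrite addnK.
(* T starts as X^d; each step corrects one more coefficient of h - T^2. *)
elim: j => [_|j IH ltjd].
  by exists 'X^d; rewrite subrr size_poly0 subn0 -exprM muln2 -addnn.
have [T [hT hhT]] := IH (ltnW ltjd).
set i := (d - j.+1)%N.
have di : (d + d - j.+1 = d + i)%N by rewrite /i; lia.
have ltid : (i < d)%N by rewrite /i; lia.
have hhT' : (size (h - T ^+ 2)%R <= (d + i).+1)%N.
  by apply: leq_trans hhT _; rewrite -di; lia.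
pose c := (h - T ^+ 2)`_(d + i).
(* To first order T^2 changes by 2 X^d eps, which has to cancel c X^(d + i). *)
pose eps : {poly R} := (half * c) *: 'X^i.
have heps : (size eps <= i.+1)%N.
  by apply: leq_trans (size_scale_leq _ _) _; rewrite size_polyXn.
exists (T + eps); split.
  rewrite addrAC; apply: size_add_leq => //; exact: leq_trans heps ltid.
rewrite di.
have eps2 : eps + eps = c *: 'X^i.
  by rewrite /eps -scalerDl -mulrDl half2 mul1r.
have -> : h - (T + eps) ^+ 2 = (h - T ^+ 2 - c *: 'X^(d + i))
     - (T - 'X^d) * (eps + eps) - eps * eps.
  have -> : c *: 'X^(d + i) = 'X^d * (eps + eps) by rewrite eps2 exprD scalerAr.
  ring.
apply: size_sub_leq; last by apply: (size_mul_le heps heps); lia.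
apply: size_sub_leq.
  apply/leq_sizeP => l; rewrite leq_eqVlt => /predU1P[<-|hl].
    by rewrite coefB coefZ coefXn eqxx mulr1 subrr.
  rewrite coefB coefZ coefXn gtn_eqF // mulr0 subr0.
  by apply: (leq_sizeP _ _ hhT').
by apply: (size_mul_le hT (size_add_leq heps heps)); lia.
Qed.

(** * The polynomial Pell equation as a linear condition *)

Lemma pell_leading_terms (K : fieldType) (f A B : {poly K}) (e : nat) (c : K) :
    (0 < e)%N -> f \is monic -> size f = (e + e).+1 -> B != 0 ->
    A ^+ 2 - f * B ^+ 2 = c%:P ->
  size A = (size B + e)%N /\ lead_coef A ^+ 2 = lead_coef B ^+ 2.
Proof.
move=> e_gt0 f_monic size_f B0 pell.
have f0 : f != 0 by rewrite monic_neq0.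
have hA2 : A ^+ 2 = f * B ^+ 2 + c%:P by rewrite -pell addrC subrK.
have sB_gt0 : (0 < size B)%N by rewrite size_poly_gt0.
have sfB : size (f * B ^+ 2) = (size B + e + (size B + e)).-1.
  by rewrite size_mul ?expf_neq0 // expr2 size_mul // size_f;
     move: (size B) sB_gt0 => s; lia.
have sc : (size c%:P < size (f * B ^+ 2)%R)%N.
  by apply: leq_ltn_trans (size_polyC_leq1 _) _; rewrite sfB; lia.
have sA2 : size (A ^+ 2) = (size B + e + (size B + e)).-1.
  by rewrite hA2 size_polyDl.
split; last first.
  by rewrite -!lead_coef_exp hA2 lead_coefDl // lead_coefM
             (monicP f_monic) mul1r.
have A0 : A != 0.
  by apply/eqP => A0; move: sA2; rewrite A0 expr0n size_poly0; lia.
move: sA2 (size_poly_gt0 A); rewrite A0 expr2 size_mul //.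
by move: (size A) => s; lia.
Qed.

(** Throughout, q bounds the degree of B, m is the resulting degree of A, and T
    is the polynomial part of X^k sqrt f. The value k = 2m is large enough for
    the error of T not to interfere with the degrees that matter. *)
Section Pell.
Variables (K : fieldType) (f T : {poly K}) (e q : nat).
Let m := (q + e)%N.
Let k := (m + m)%N.
Hypothesis T_lead : (size (T - 'X^(k + e))%R <= k + e)%N.
Hypothesis T_sqrt : (size ('X^(k + k) * f - T ^+ 2)%R <= k + e)%N.

Definition window_zero (B : {poly K}) :=
  forall i, (m < i < k)%N -> (T * B)`_i = 0.

Lemma size_T : size T = (k + e).+1.
Proof.
by rewrite -[T](subrK 'X^(k + e)) addrC size_polyDl size_polyXn // ltnS.
Qed.

Lemma T_monic : T \is monic.
Proof.
rewrite -[T](subrK 'X^(k + e)) addrC monicE lead_coefDl ?lead_coefXn //.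
by rewrite size_polyXn ltnS.
Qed.

(** The polynomial A is read off as the part of T B in degrees at least k: the
    remainder r has degree at most m, and then
    X^(2k) (A^2 - f B^2) = (T B - r)^2 - X^(2k) f B^2 has degree at most 2k. *)
Lemma window_pell (B : {poly K}) : (size B <= q.+1)%N -> window_zero B ->
  exists A c, A ^+ 2 - f * B ^+ 2 = c%:P.
Proof.
move=> sB win.
pose A := drop_poly k (T * B); pose r := take_poly k (T * B).
have TB : T * B = r + A * 'X^k by rewrite poly_take_drop.
have sr : (size r <= m.+1)%N.
  apply/leq_sizeP => i mi; rewrite coef_take_poly; case: ltnP => // ik.
  by apply: win; rewrite mi.
have sTB : (size (T * B)%R <= (k + m).+1)%N.
  by apply: (@size_mul_le _ _ _ (k + e).+1 q.+1); rewrite ?size_T // /m; lia.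
exists A, (A ^+ 2 - f * B ^+ 2)`_0; apply: size1_polyC.
set G := A ^+ 2 - _.
have [->|G0] := eqVneq G 0; first by rewrite size_poly0.
have GX : G * 'X^(k + k) = r * r - T * B * r - T * B * r
    - ('X^(k + k) * f - T ^+ 2) * (B * B).
  have -> : r = T * B - A * 'X^k by rewrite TB addrK.
  rewrite /G exprD; ring.
have : (size (G * 'X^(k + k))%R <= (k + k).+1)%N.
  have h2 : (size (T * B * r)%R <= (k + k).+1)%N.
    by apply: (size_mul_le sTB sr); rewrite /k; lia.
  rewrite GX; do !apply: size_sub_leq => //.
    by apply: (size_mul_le sr sr); rewrite /k; lia.
  apply: (@size_mul_le _ _ _ (k + e) (q + q).+1) => //;
    last by rewrite /k /m; lia.
  by apply: (size_mul_le sB sB); lia.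
by rewrite size_mulXn // -addn1 leq_add2l.
Qed.

Hypothesis two_neq0 : 1 + 1 != 0 :> K.
Hypothesis e_gt0 : (0 < e)%N.
Hypotheses (f_monic : f \is monic) (size_f : size f = (e + e).+1).

(** Factor (X^k A - T B) (X^k A + T B) = c X^(2k) + (X^(2k) f - T^2) B^2, of
    degree at most 2k. One factor has the full degree k + m, so the other has
    degree at most m, whence T B agrees with X^k A in degrees above m. Which
    factor is large depends on the sign in front of sqrt f; replacing B by its
    opposite if necessary fixes it. *)
Lemma pell_window (A B : {poly K}) c :
    size B = q.+1 -> A ^+ 2 - f * B ^+ 2 = c%:P ->
  exists2 B' : {poly K}, size B' = q.+1 & window_zero B'.
Proof.
move=> sB pell.
have B0 : B != 0 by rewrite -size_poly_eq0 sB.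
have [sA lead2] := pell_leading_terms e_gt0 f_monic size_f B0 pell.
rewrite sB addSn in sA.
have A0 : A != 0 by rewrite -size_poly_eq0 sA.
have [B' [sB' lB' B'2]] : exists B' : {poly K}, [/\ size B' = q.+1,
    lead_coef B' = lead_coef A & B' ^+ 2 = B ^+ 2].
  move/eqP: lead2; rewrite eqf_sqr => /orP[]/eqP lAB; first by exists B.
  by exists (- B); rewrite size_polyN lead_coefN sqrrN.
exists B' => //.
have B'0 : B' != 0 by rewrite -size_poly_eq0 sB'.
pose U := 'X^k * A - T * B'; pose V := 'X^k * A + T * B'.
have sV : size V = (k + m).+1.
  have hcoef : V`_(k + m) = lead_coef A * (1 + 1).
    have lTB : lead_coef (T * B') = lead_coef A.
      by rewrite lead_coefM (monicP T_monic) mul1r.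
    have sTB : size (T * B') = (k + m).+1.
      have T0 : T != 0 by exact: monic_neq0 T_monic.
      by rewrite size_mul // size_T sB' addSn addnS /= -addnA [(e + q)%N]addnC.
    rewrite coefD coefXnM ltnNge leq_addr addKn mulrDr mulr1.
    by rewrite -{2}lTB !lead_coefE sA sTB.
  apply/eqP; rewrite eqn_leq; apply/andP; split; last first.
    rewrite ltnNge; apply/negP => /leq_sizeP /(_ _ (leqnn _)) /eqP.
    by rewrite hcoef mulf_eq0 lead_coef_eq0 (negPf A0) (negPf two_neq0).
  apply: size_add_leq.
    by apply: (@size_mul_le _ _ _ k.+1 m.+1); rewrite ?size_polyXn ?sA; lia.
  by apply: (@size_mul_le _ _ _ (k + e).+1 q.+1); rewrite ?size_T ?sB' /m; lia.
have V0 : V != 0 by rewrite -size_poly_eq0 sV.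
have UV : U * V = c *: 'X^(k + k) + ('X^(k + k) * f - T ^+ 2) * B' ^+ 2.
  rewrite mulrBl B'2 mulrAC -mulrA -mul_polyC -pell -B'2 /U /V exprD; ring.
have sUV : (size (U * V)%R <= (k + k).+1)%N.
  rewrite UV; apply: size_add_leq.
    by apply: leq_trans (size_scale_leq _ _) _; rewrite size_polyXn.
  apply: (@size_mul_le _ _ _ (k + e) (q + q).+1) => //;
    last by rewrite /k /m; lia.
  by apply: (@size_mul_le _ _ _ q.+1 q.+1); rewrite ?sB'; lia.
have sU : (size U <= m.+1)%N.
  have [->|U0] := eqVneq U 0; first by rewrite size_poly0.
  by move: sUV; rewrite size_mul // sV /k /m; case: (size U) => [|s]; lia.
move=> i /andP[mi ik].
have := leq_sizeP _ _ sU i mi.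
by rewrite coefB coefXnM ik sub0r => /eqP; rewrite oppr_eq0 => /eqP.
Qed.

End Pell.

(** * A degenerate polynomial without Pell solutions *)

Lemma deriv_eq0_size (K : numFieldType) (p : {poly K}) :
  p^`() = 0 -> (size p <= 1)%N.
Proof.
move=> dp; apply/leq_sizeP => -[//|i] _.
have /eqP := coef_deriv p i.
by rewrite dp coef0 eq_sym mulrn_eq0 => /eqP.
Qed.

(** Write f for the coefficient of B^2. For c = 0, the root 1 would have even
    multiplicity in A^2 and odd multiplicity in f B^2.
    For c <> 0, put p = 2r. Differentiating gives 2 A A' = (f B^2)', a multiple
    of X^p B, and so is c A' = A (A A') - f B^2 A'. Comparing degrees yields
    2r + deg B <= deg A' < deg B + r + 1 unless A' = 0, in which case A is
    constant, again contradicting its degree. *)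
Lemma no_pell_degenerate (K : numFieldType) (r : nat) (A B : {poly K}) (c : K) :
    (0 < r)%N ->
    A ^+ 2 - 'X^((r + r).+1) * ('X - 1%:P) * B ^+ 2 = c%:P ->
  B = 0.
Proof.
move=> r_gt0 pell; apply/eqP/negPn/negP => B0.
set p := (r + r)%N in pell; set f := 'X^(p.+1) * _ in pell.
have Xp_neq0 i : 'X^i != 0 :> {poly K} by rewrite monic_neq0 ?monicXn.
have X1_neq0 : 'X - 1%:P != 0 :> {poly K} by rewrite polyXsubC_eq0.
have f_monic : f \is monic by rewrite monicMl ?monicXn ?monicXsubC.
have size_f : size f = (r.+1 + r.+1).+1.
  by rewrite size_mul ?Xp_neq0 // size_polyXn size_XsubC /p; lia.
have [sA _] := pell_leading_terms (ltn0Sn r) f_monic size_f B0 pell.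
have sB_gt0 : (0 < size B)%N by rewrite size_poly_gt0.
have A0 : A != 0 by rewrite -size_poly_eq0 sA; lia.
have [c0|c_neq0] := eqVneq c 0.
  move: pell; rewrite c0 => /eqP; rewrite subr_eq0 => /eqP /(congr1 (mup 1)).
  rewrite !expr2 !mupM ?mulf_neq0 ?Xp_neq0 //.
  rewrite (@mupNroot _ _ 'X^_) ?rootE ?hornerXn ?expr1n ?oner_neq0 //.
  by rewrite -['X - 1%:P]expr1 mup_XsubCX eqxx; lia.
pose a : {poly K} := p.+1%:R%:P.
pose H := (a * ('X - 1%:P) + 'X) * B + ('X * ('X - 1%:P) * B^`()) *+ 2.
have dA : (A * A^`()) *+ 2 = 'X^p * B * H.
  have /eqP := congr1 (@deriv K) pell; rewrite derivC derivB subr_eq0 => /eqP.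
  rewrite !expr2 !derivM derivXn derivB derivX derivC subr0 => dA.
  have -> : (A * A^`()) *+ 2 = A^`() * A + A * A^`() by ring.
  rewrite dA /H /f -[p.+1.-1]/p exprS -mulr_natl -[p.+1%:R]polyC_natr -/a.
  ring.
have dvdA : 'X^p * B %| A^`().
  have -> : A^`() = 'X^p * B *
     (c^-1 *: (2^-1 *: (A * H) - 'X * ('X - 1%:P) * B * A^`())).
    apply: (scalerI c_neq0).
    rewrite -scalerAr scalerA divff // scale1r -mul_polyC -pell.
    have -> : 2^-1 *: (A * H) = A * (2^-1 *: H) by rewrite scalerAr.
    have half : 'X^p * B * (2^-1 *: H) = A * A^`().
      by rewrite -scalerAr -dA -scaler_nat scalerA mulVf ?pnatr_eq0 // scale1r.
    rewrite [RHS]mulrBr [X in _ = X - _]mulrCA half /f.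
    rewrite [X in _ - X * _ * _]exprS; ring.
  exact: dvdp_mulr.
have [dA0|dA_neq0] := eqVneq A^`() 0.
  by have := deriv_eq0_size dA0; rewrite sA; lia.
have := dvdp_leq dA_neq0 dvdA; rewrite size_mul ?Xp_neq0 //.
have := lt_size_deriv A0; rewrite sA size_polyXn /p.
by move: (size _) (size B) => s t; lia.
Qed.

(** * Dependence on the roots *)

Lemma size_sub_monic (R : nzRingType) (p : {poly R}) n :
  p \is monic -> size p = n.+1 -> (size (p - 'X^n)%R <= n)%N.
Proof.
move=> p_monic sp; apply/leq_sizeP => i; rewrite coefB coefXn.
rewrite leq_eqVlt => /predU1P[<-|ni].
  by have := monicP p_monic; rewrite lead_coefE sp eqxx => ->; rewrite subrr.
by rewrite gtn_eqF // subr0 nth_default // sp.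
Qed.

Lemma split_poly_monic (K : fieldType) n (lam : 'I_n -> K) :
  split_poly lam \is monic.
Proof. exact: monic_prod_XsubC. Qed.

Lemma size_split_poly (K : fieldType) n (lam : 'I_n -> K) :
  size (split_poly lam) = n.+1.
Proof.
by rewrite size_prod_XsubC -[index_enum _]enumT size_enum_ord.
Qed.

Definition universal_split_poly (K : fieldType) n : {poly {mpoly K[n]}} :=
  \prod_(i < n) ('X - ('X_i)%:P).

Lemma universal_split_polyE (K : fieldType) n (lam : 'I_n -> K) :
  map_poly (meval lam) (universal_split_poly K n) = split_poly lam.
Proof.
rewrite rmorph_prod; apply: eq_bigr => i _.
by rewrite rmorphB /= map_polyX map_polyC /= mevalXU.
Qed.

(** The matrix of the linear map sending B, of degree at most q, to the
    coefficients of T B in degrees m + 1, ..., 2m - 1. *)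
Definition window_mx (R : nzRingType) (T : {poly R}) (q m : nat) :
  'M[R]_(q.+1, m.-1) := \matrix_(i, j) (T * 'X^i)`_(m.+1 + j).

Lemma map_window_mx (R S : nzRingType) (phi : {rmorphism R -> S})
    (T : {poly R}) q m :
  map_mx phi (window_mx T q m) = window_mx (map_poly phi T) q m.
Proof.
by apply/matrixP => i j; rewrite !mxE -coef_map rmorphM /= map_polyXn.
Qed.

Lemma mul_window_mx (R : comNzRingType) (T : {poly R}) q m (w : 'rV_q.+1) j :
  (w *m window_mx T q m) 0 j = (T * rVpoly w)`_(m.+1 + j).
Proof.
rewrite {2}(row_sum_delta w) linear_sum mulr_sumr coef_sum mxE.
by apply: eq_bigr => i _; rewrite linearZ /= rVpoly_delta -scalerAr coefZ !mxE.
Qed.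

Lemma window_zeroP (K : fieldType) (T : {poly K}) e q (w : 'rV_q.+1) :
  w *m window_mx T q (q + e) = 0 <-> window_zero T e q (rVpoly w).
Proof.
split=> [w0 i /andP[mi ik]|win].
  have ltj : (i - (q + e).+1 < (q + e).-1)%N by lia.
  have := mul_window_mx T w (Ordinal ltj).
  by rewrite w0 mxE /= subnKC.
apply/rowP => j; rewrite mul_window_mx mxE; apply: win.
by have := ltn_ord j; lia.
Qed.

Lemma no_pell_odd (K : fieldType) (f A B : {poly K}) (c : K) :
    f != 0 -> ~~ odd (size f) -> B != 0 -> A ^+ 2 - f * B ^+ 2 <> c%:P.
Proof.
move=> f0 odd_f B0 pell.
have hA2 : A ^+ 2 = f * B ^+ 2 + c%:P by rewrite -pell addrC subrK.
have sf_gt0 : (0 < size f)%N by rewrite size_poly_gt0.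
have sfB : size (f * B ^+ 2) = (size f + (size B).-1 + (size B).-1)%N.
  rewrite size_mul ?expf_neq0 // expr2 size_mul //.
  move: (size_poly_gt0 B); rewrite B0; move: (size B) (size f) => b a.
  by lia.
have sA2 : size (A ^+ 2) = size (f * B ^+ 2).
  rewrite hA2 size_polyDl //; apply: leq_ltn_trans (size_polyC_leq1 _) _.
  by rewrite sfB; move: sf_gt0 odd_f; move: (size f) => [|[]] // *; lia.
have A0 : A != 0.
  apply/eqP => A0; have /eqP := sA2.
  by rewrite A0 expr0n size_poly0 eq_sym size_poly_eq0 mulf_eq0
             expf_eq0 (negPf f0) (negPf B0).
move: sA2; rewrite sfB expr2 size_mul //.
move: (size_poly_gt0 A) odd_f sf_gt0; rewrite A0.
by move: (size A) (size f) (size B) => a b d; lia.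
Qed.

Definition degenerate_roots (K : fieldType) n : 'I_n.+1 -> K :=
  fun i => if i == ord0 then 1 else 0.

Lemma split_degenerate_roots (K : fieldType) n :
  split_poly (@degenerate_roots K n) = 'X^n * ('X - 1%:P).
Proof.
rewrite /split_poly big_ord_recl /degenerate_roots eqxx mulrC; congr (_ * _).
under eq_bigr do rewrite eq_sym -[_ == _]negbK neq_lift subr0.
by rewrite prodr_const card_ord.
Qed.

(** One hypersurface contains all root tuples for which the Pell equation has a
    solution with B of degree exactly q, and it is not the whole space. *)
Lemma pell_obstruction (K : numFieldType) (n q : nat) : (3 <= n)%N ->
  exists P : {mpoly K[n]}, (exists v, P.@[v] != 0) /\
    forall lam (A B : {poly K}) c, P.@[lam] != 0 -> size B = q.+1 ->
      A ^+ 2 - split_poly lam * B ^+ 2 <> c%:P.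
Proof.
move=> n_ge3.
have [odd_n|even_n] := boolP (odd n).
  exists 1; split; first by exists (fun=> 0); rewrite rmorph1 oner_neq0.
  move=> lam A B c _ sB; apply: no_pell_odd.
  - exact/monic_neq0/split_poly_monic.
  - by rewrite size_split_poly /= odd_n.
  - by rewrite -size_poly_eq0 sB.
have [r r_gt0 nE] : exists2 r, (0 < r)%N & n = (r + r).+2.
  by exists n./2.-1; lia.
subst n => {n_ge3 even_n}.
(* The degenerate polynomial X^(2r+1) (X - 1) has degree n = 2e = 2r + 2. *)
pose e := r.+1; pose m := (q + e)%N; pose k := (m + m)%N.
have nE : (r + r).+2 = (e + e)%N by rewrite /e; lia.
pose n := (r + r).+2; rewrite -/n in nE *.
pose F := universal_split_poly K n; pose half : {mpoly K[n]} := (2^-1)%:MP.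
have half2 : half + half = 1.
  have half2 : 2^-1 + 2^-1 = 1 :> K.
    have : (1 + 1) * 2^-1 = 1 :> K by rewrite -mulr2n divff ?pnatr_eq0.
    by rewrite mulrDl mul1r.
  by rewrite /half -mpolyCD half2.
have F_monic : F \is monic by exact: monic_prod_XsubC.
have size_F : size F = n.+1.
  by rewrite size_prod_XsubC -[index_enum _]enumT size_enum_ord.
have hF : (size ('X^(k + k) * F - 'X^(k + e + (k + e)))%R <= k + e + (k + e))%N.
  apply: size_sub_monic; first by rewrite monicMl ?monicXn.
  by rewrite size_monicM ?monicXn ?monic_neq0 // size_F size_polyXn nE; lia.
have [T [T_lead T_sqrt]] := monic_sqrt_approx half2 hF.
pose Tv v := map_poly (meval v) T.
have Tv_lead v : (size (Tv v - 'X^(k + e))%R <= k + e)%N.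
  rewrite -(map_polyXn (meval v)) -rmorphB.
  exact: leq_trans (size_poly _ _) T_lead.
have Tv_sqrt v :
    (size ('X^(k + k) * split_poly v - Tv v ^+ 2)%R <= k + e)%N.
  rewrite -(map_polyXn (meval v)) -universal_split_polyE -rmorphXn -rmorphM.
  rewrite -rmorphB; exact: leq_trans (size_poly _ _) T_sqrt.
have two_neq0 : 1 + 1 != 0 :> K by rewrite -mulr2n pnatr_eq0.
have e_gt0 : (0 < e)%N by [].
have size_f (v : 'I_n -> K) : size (split_poly v) = (e + e).+1.
  by rewrite size_split_poly nE.
pose M := window_mx T q m; pose Mv v := window_mx (Tv v) q m.
have MvE v : map_mx (meval v) M = Mv v by exact: map_window_mx.
pose v0 := @degenerate_roots K (r + r).+1.
have /row_freeP[L M0L] : row_free (Mv v0).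
  apply/inj_row_free => w /window_zeroP win.
  have [|A [c pell]] := window_pell (Tv_lead v0) (Tv_sqrt v0) _ win.
    by rewrite size_poly.
  apply: (can_inj rVpolyK); rewrite linear0.
  move: pell; rewrite split_degenerate_roots; exact: no_pell_degenerate.
(* Compared with a choice of maximal minor, the fixed right inverse L at v0
   singles out one determinant without naming columns. *)
exists (\det (M *m map_mx (@mpolyC n K) L)).
have detE v : (\det (M *m map_mx (@mpolyC n K) L)).@[v] = \det (Mv v *m L).
  rewrite -det_map_mx map_mxM MvE -map_mx_comp; congr (\det (_ *m _)).
  by apply/matrixP => i j; rewrite !mxE /= mevalC.
split; first by exists v0; rewrite detE M0L det1 oner_neq0.
move=> lam A B c P_neq0 sB pell.
have [B' sB' win] := pell_window (Tv_lead lam) (Tv_sqrt lam) two_neq0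
  e_gt0 (split_poly_monic lam) (size_f lam) sB pell.
have B'E : rVpoly (poly_rV B' : 'rV_q.+1) = B' by rewrite poly_rV_K ?sB'.
move: P_neq0; rewrite detE => /negP; apply; apply/det0P.
exists (poly_rV B').
  by apply/eqP => B'0; move: sB'; rewrite -B'E B'0 linear0 size_poly0.
by rewrite mulmxA (window_zeroP _ _ _).2 ?mul0mx // B'E.
Qed.

(** * Units of the coordinate ring *)

Section CoordinateRing.
Variables (K : closedFieldType) (f : {poly K}).
Implicit Types (A B : {poly K}) (p : {mpoly K[2]}).

Local Notation poly_in_x := (horner_alg (coord_x K)).

Lemma coord_class_eqP p1 p2 :
  coord_class f p1 = coord_class f p2 <->
  exists q, p1 - p2 = q * curve_eqn f.
Proof.
split=> [/eqP|h]; first by rewrite /coord_class -Quotient.idealrBE => /asboolP.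
by apply/eqP; rewrite /coord_class -Quotient.idealrBE; apply/asboolP.
Qed.

Lemma coord_classM p1 p2 :
  coord_class f (p1 * p2) = coord_class f p1 * coord_class f p2.
Proof. exact: rmorphM. Qed.

Lemma coord_class1 : coord_class f 1 = 1.
Proof. exact: rmorph1. Qed.

Definition linear_in_y A B : {mpoly K[2]} :=
  poly_in_x A + poly_in_x B * coord_y K.

Definition pell_norm A B : {poly K} := A ^+ 2 - f * B ^+ 2.

(** Polynomials of this form are closed under sums and, because y^2 = f(x)
    modulo the equation, under products; they contain constants and variables.
*)
Lemma linear_in_y_mod p :
  exists A B q, p = linear_in_y A B + q * curve_eqn f.
Proof.
pose P p := exists A B q, p = linear_in_y A B + q * curve_eqn f.
have PC c : P c%:MP.
  exists c%:P, 0, 0; rewrite /linear_in_y horner_algC rmorph0 !mul0r !addr0.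
  by rewrite -mul_mpolyC mulr1.
have PM p1 p2 : P p1 -> P p2 -> P (p1 * p2).
  move=> [A1 [B1 [q1 ->]]] [A2 [B2 [q2 ->]]].
  exists (A1 * A2 + f * (B1 * B2)), (A1 * B2 + B1 * A2).
  exists (poly_in_x (B1 * B2) + q1 * linear_in_y A2 B2
          + linear_in_y A1 B1 * q2 + q1 * q2 * curve_eqn f).
  rewrite /linear_in_y /curve_eqn !rmorphD !rmorphM /=; ring.
have PD p1 p2 : P p1 -> P p2 -> P (p1 + p2).
  move=> [A1 [B1 [q1 ->]]] [A2 [B2 [q2 ->]]].
  exists (A1 + A2), (B1 + B2), (q1 + q2).
  rewrite /linear_in_y !rmorphD /=; ring.
have PX (i : 'I_2) : P 'X_i.
  have [->|->] : i = inord 0 \/ i = inord 1.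
    case: i => -[|[|//]] h; [left|right]; apply: val_inj;
    by rewrite /= inordK.
  - exists 'X, 0, 0; rewrite /linear_in_y horner_algX rmorph0.
    by rewrite !mul0r !addr0.
  - exists 0, 1, 0; rewrite /linear_in_y rmorph0 rmorph1.
    by rewrite mul0r mul1r add0r addr0.
change (P p); rewrite (mpolyE p); elim/big_ind: _ => [||mon _].
- by have := PC 0; rewrite mpolyC0.
- exact: PD.
rewrite -mul_mpolyC mpolyXE_id; apply: (PM) => //.
elim/big_ind: _ => [||i _]; [exact: PC 1 | exact: PM |].
elim: (mon i) => [|j IH]; first exact: PC 1.
by rewrite exprS; apply: (PM).
Qed.

Lemma coord_class_linear (u : coord_ring f) :
  exists A B, u = coord_class f (linear_in_y A B).
Proof.
have [A [B [q hq]]] := linear_in_y_mod (repr u).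
exists A, B; rewrite -[LHS]reprK; apply/coord_class_eqP; exists q.
by rewrite [X in X - _]hq addrC addKr.
Qed.

Definition plane_point (x y : K) : 'I_2 -> K :=
  fun i => if i == inord 0 then x else y.

Lemma meval_linear_in_y A B x y :
  (linear_in_y A B).@[plane_point x y] = A.[x] + B.[x] * y.
Proof.
rewrite mevalD mevalM !horner_alg_meval mevalXU /plane_point eqxx.
by rewrite -val_eqE /= !inordK.
Qed.

Lemma meval_curve_eqn x y :
  (curve_eqn f).@[plane_point x y] = y ^+ 2 - f.[x].
Proof.
rewrite mevalB horner_alg_meval rmorphXn /= mevalXU /plane_point eqxx.
by rewrite -val_eqE /= !inordK.
Qed.

Lemma closed_sqrt (c : K) : exists y, y ^+ 2 = c.
Proof.
have /closed_rootP[y] : size ('X^2 - c%:P) != 1 by rewrite size_XnsubC.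
by rewrite rootE !hornerE subr_eq0 => /eqP; exists y.
Qed.

Lemma closed_poly_eq0 (p : {poly K}) : (forall x, p.[x] = 0) -> p = 0.
Proof.
move=> p0; apply/eqP/negPn/negP => /closed_nonrootP[x].
by rewrite rootE p0 eqxx.
Qed.

(** The norm of u at x is the product of the values of u at the two points (x, y)
    and (x, -y) of the curve, where u and its inverse multiply to 1. Checking
    this at every x avoids proving that 1 and y are independent over k[x]. *)
Lemma pell_norm_unit A1 B1 A2 B2 :
    coord_class f (linear_in_y A1 B1) * coord_class f (linear_in_y A2 B2) = 1 ->
  pell_norm A1 B1 * pell_norm A2 B2 = 1.
Proof.
rewrite -coord_classM -coord_class1 => /coord_class_eqP[q hq].
apply/eqP; rewrite -subr_eq0; apply/eqP/closed_poly_eq0 => x.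
have [y hy] := closed_sqrt f.[x].
have val z : z ^+ 2 = f.[x] ->
    (A1.[x] + B1.[x] * z) * (A2.[x] + B2.[x] * z) = 1.
  move=> hz; have := congr1 (meval (plane_point x z)) hq.
  rewrite mevalB !mevalM !meval_linear_in_y meval_curve_eqn hz subrr mulr0.
  by rewrite rmorph1 => /eqP; rewrite subr_eq0 => /eqP.
have := congr2 *%R (val y hy) (val (- y) (etrans (sqrrN y) hy)).
rewrite mulr1 => normE; rewrite /pell_norm.
rewrite !(hornerD, hornerN, hornerM, horner_exp, hornerC) -hy -normE; ring.
Qed.

Lemma coord_units_const :
    (forall A B c, pell_norm A B = c%:P -> B = 0) ->
  ring_units (coord_ring f) = coord_const f @` ring_units K.
Proof.
move=> no_pell; apply/seteqP; split=> [u /= u_unit|_ [c c_unit <-]]; last first.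
  apply/unitrPr; exists (coord_const f c^-1).
  by rewrite /coord_const -coord_classM -mpolyCM divrr // mpolyC1 coord_class1.
have [v uv] := unitrPr u_unit.
have [A [B uE]] := coord_class_linear u.
have [A' [B' vE]] := coord_class_linear v.
move: uv; rewrite uE vE => /pell_norm_unit normM.
have : pell_norm A B \is a GRing.unit.
  by apply/unitrPr; exists (pell_norm A' B').
rewrite poly_unitE => /andP[/eqP s1 _].
have normE : pell_norm A B = ((pell_norm A B)`_0)%:P.
  by apply: size1_polyC; rewrite s1.
have B0 := no_pell _ _ _ normE.
have A_unit : A \is a GRing.unit.
  apply/unitrPr; exists (A * pell_norm A' B'); rewrite mulrA -normM.
  by rewrite /pell_norm B0 expr0n mulr0 subr0 expr2.
move: A_unit; rewrite poly_unitE => /andP[/eqP sA A0_unit].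
exists A`_0 => //; rewrite /coord_const /linear_in_y B0 rmorph0 mul0r addr0.
rewrite [in RHS](@size1_polyC _ A) ?sA // horner_algC.
by rewrite -mul_mpolyC mulr1.
Qed.

End CoordinateRing.

Lemma zero_set1_closed (K : fieldType) n (P : {mpoly K[n]}) :
  zariski_closed [set v | P.@[v] = 0].
Proof.
exists [set P]; apply/seteqP; split=> v /=; first by move=> h p ->.
by apply.
Qed.

Theorem proposition3p7 (R : realType) (n : nat) (hn : (3 <= n)%N) :
  exists Z : nat -> set ('I_n -> R[i]),
    (forall m, zariski_closed (Z m) /\ Z m `<` setT) /\
    (forall lam : 'I_n -> R[i], injective lam -> ~ (\bigcup_m Z m) lam ->
       ring_units (coord_ring (split_poly lam)) =
       coord_const (split_poly lam) @` ring_units R[i]).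
Proof.
have [P PP] := choice (fun q => @pell_obstruction R[i] n q hn).
exists (fun q => [set v | (P q).@[v] = 0]); split=> [q|lam _ lamZ].
  split; first exact: zero_set1_closed.
  have [[v Pv] _] := PP q; split=> // /(_ v I) /= Pv0.
  by rewrite Pv0 eqxx in Pv.
apply: coord_units_const => A B c pell.
apply/eqP/negPn/negP => B0.
have [_ obs] := PP (size B).-1.
apply: (obs lam A B c) pell; last by rewrite prednK // size_poly_gt0.
by apply/eqP => Pv0; apply: lamZ; exists (size B).-1.
Qed.
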